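(* Let $a,b,c$ be nonzero vectors in $\mathbb{R}^2$, where $\mathbb{R}^2$ is identified with $\mathbb{C}$. Then $\mathsf{ta}_{a,b}+\mathsf{ta}_{b,c}+\mathsf{ta}_{c,a}=2\pi$ if and only if one of the following two alternatives holds: (I) $0<\max(\mathsf{oa}_{a,b},\mathsf{oa}_{b,c},\mathsf{oa}_{c,a})\le\pi$; (II) $\min(\mathsf{oa}_{a,b},\mathsf{oa}_{b,c},\mathsf{oa}_{c,a})\ge\pi$.
   Context: Identify $\mathbb{R}^2$ with the set $\mathbb{C}$ of complex numbers. For nonzero $a,b\in\mathbb{C}$: - The oriented angle $\mathsf{oa}_{a,b}$ from $a$ to $b$ is the value in $[0,2\pi)$ of the argument of the ratio $b/a$; that is, $\mathsf{oa}_{a,b}=t$ if $b/a=re^{it}$ for some real $r>0$ and some real $t\in[0,2\pi)$. - The turning angle from $a$ to $b$ is $\mathsf{ta}_{a,b}:=\min(\mathsf{oa}_{a,b},\,2\pi-\mathsf{oa}_{a,b})$. *)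

(* Defs.v *)
(* Coquelicot's [C] is by definition [R * R], so the plane is literally
   identified with the complex numbers. *)
From Stdlib Require Import Reals Lra ClassicalEpsilon.
From Coquelicot Require Import Coquelicot.
Open Scope R_scope.

(* e^{it}, by Euler's formula: Coquelicot has no complex exponential. *)
Definition expi (t : R) : C := (cos t, sin t).

Definition is_oa (a b : C) (t : R) : Prop :=
  0 <= t < 2 * PI /\
  exists r : R, 0 < r /\ (b / a)%C = (RtoC r * expi t)%C.

(* When a or b is zero no t satisfies [is_oa a b t] and the value is junk;
   otherwise [oa_spec] and [oa_unique] characterize it. *)
Definition oa (a b : C) : R := epsilon (inhabits 0) (is_oa a b).

Definition ta (a b : C) : R := Rmin (oa a b) (2 * PI - oa a b).

Lemma polar_form (z : C) : z <> 0%C ->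
  exists t r : R, 0 <= t < 2 * PI /\ 0 < r /\ z = (RtoC r * expi t)%C.
Proof.
intros Hz.
pose proof (Cmod_gt_0 z) as [Hr _]; specialize (Hr Hz).
assert (Hsq : Cmod z * Cmod z = fst z * fst z + snd z * snd z).
{ unfold Cmod; rewrite sqrt_sqrt; [simpl; ring | simpl; nra]. }
destruct z as [x y]; simpl fst in Hsq; simpl snd in Hsq.
set (r := Cmod (x, y)) in *.
assert (Hx : r * (x / r) = x) by (field; lra).
assert (Hy : r * (y / r) = y) by (field; lra).
set (u := x / r) in *; set (v := y / r) in *.
assert (Huv : u * u + v * v = 1).
{ apply Rmult_eq_reg_l with (r * r); [|nra].
  rewrite Rmult_1_r; rewrite <- Hx, <- Hy in Hsq; rewrite Hsq at 2; ring. }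
assert (Hu : -1 <= u <= 1) by (split; nra).
pose proof (acos_bound u) as Hb.
pose proof (sin_acos u Hu) as Hs.
pose proof PI_RGT_0 as Hpi.
destruct (Rle_dec 0 v) as [Hv | Hv].
- exists (acos u), r; repeat split; try lra.
  unfold expi, RtoC, Cmult; simpl; rewrite cos_acos, Hs by lra.
  replace (1 - Rsqr u) with (Rsqr v) by (unfold Rsqr; lra).
  rewrite sqrt_Rsqr by lra.
  f_equal; lra.
- assert (Hneq : acos u <> 0).
  { intros H0; rewrite H0, sin_0 in Hs; symmetry in Hs.
    apply sqrt_eq_0 in Hs; unfold Rsqr in *; nra. }
  exists (2 * PI - acos u), r; repeat split; try lra.
  unfold expi, RtoC, Cmult; simpl.
  replace (2 * PI - acos u) with (- acos u + 2 * PI) by ring.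
  rewrite cos_plus, sin_plus, cos_2PI, sin_2PI, cos_neg, sin_neg, cos_acos, Hs by lra.
  replace (1 - Rsqr u) with (Rsqr (- v)) by (unfold Rsqr; lra).
  rewrite sqrt_Rsqr by lra.
  f_equal; lra.
Qed.

Lemma oa_spec (a b : C) : a <> 0%C -> b <> 0%C -> is_oa a b (oa a b).
Proof.
intros Ha Hb; unfold oa; apply epsilon_spec.
assert (Hq : (b / a)%C <> 0%C).
{ intros H; apply Hb; replace b with (b / a * a)%C by (field; exact Ha).
  rewrite H; ring. }
destruct (polar_form _ Hq) as (t & r & Ht & Hr & Hz).
exists t; split; [exact Ht | exists r; auto].
Qed.

Lemma is_oa_unique (a b : C) (s t : R) : is_oa a b s -> is_oa a b t -> s = t.
Proof.
intros [Hs [r [Hr Er]]] [Ht [q [Hq Eq]]].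
rewrite Er in Eq; unfold expi, RtoC, Cmult in Eq; simpl in Eq.
injection Eq as E1 E2.
pose proof (sin2_cos2 s) as Ps; pose proof (sin2_cos2 t) as Pt.
unfold Rsqr in Ps, Pt.
assert (E1' : r * cos s = q * cos t) by lra.
assert (E2' : r * sin s = q * sin t) by lra.
assert (Hrq : r = q).
{ assert (r * r = q * q); [|nra].
  transitivity ((r * cos s) * (r * cos s) + (r * sin s) * (r * sin s)).
  - transitivity (r * r * (sin s * sin s + cos s * cos s)); [rewrite Ps|]; ring.
  - rewrite E1', E2'.
    transitivity (q * q * (sin t * sin t + cos t * cos t)); [|rewrite Pt]; ring. }
subst q.
apply Rmult_eq_reg_l in E1'; [|lra].
apply Rmult_eq_reg_l in E2'; [|lra].
assert (Hc : cos (2 * ((s - t) / 2)) = 1).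
{ replace (2 * ((s - t) / 2)) with (s - t) by field.
  rewrite cos_minus, E1', E2'; lra. }
rewrite cos_2a_sin in Hc.
assert (H0 : sin ((s - t) / 2) = 0) by nra.
destruct (Rtotal_order s t) as [H | [H | H]]; [|exact H|].
- assert (0 < sin (- ((s - t) / 2))) by (apply sin_gt_0; lra).
  rewrite sin_neg in *; lra.
- assert (0 < sin ((s - t) / 2)) by (apply sin_gt_0; lra); lra.
Qed.

Lemma oa_unique (a b : C) (t : R) :
  a <> 0%C -> b <> 0%C -> is_oa a b t -> oa a b = t.
Proof. intros Ha Hb; apply is_oa_unique, oa_spec; assumption. Qed.

(* Main.v *)
Require Import Defs.
From Stdlib Require Import Reals Lra Lia.
From Coquelicot Require Import Coquelicot.
Open Scope R_scope.

(** The product of the ratios [b/a], [c/b], [a/c] is 1, so the three oriented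
    angles add up to a multiple of [2 * PI]; as each lies in [[0, 2 * PI)], the
    sum is 0, [2 * PI] or [4 * PI] ([oa_cycle_sum]).

    - Sum 0: all three angles vanish, so the turning angles sum to 0 and both
      alternatives fail.
    - Sum [2 * PI]: alternative (II) would force a sum of at least [3 * PI].  If
      no angle exceeds [PI], each turning angle is the oriented one and their
      sum is [2 * PI].  If one angle [x] exceeds [PI], the other two add up to
      [2 * PI - x < PI], so the turning angles sum to
      [2 * (2 * PI - x) < 2 * PI].
    - Sum [4 * PI]: the substitution [x -> 2 * PI - x], which preserves turning
      angles, leads back to the previous case and exchanges (I) with (II).

    Once the sum is known, what remains is linear arithmetic ([turning_sum_iff]). *)

Lemma expi_plus (s t : R) : expi (s + t) = (expi s * expi t)%C.
Proof.
unfold expi, Cmult; simpl; rewrite cos_plus, sin_plus; f_equal; ring.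
Qed.

(** Half-angles turn the two conditions [sin t = 0] and [cos t > 0] into the
    single equation [sin (t / 2) = 0], whose solutions are the multiples of
    [PI]. *)
Lemma expi_positive_real (r t : R) :
  0 < r -> (RtoC r * expi t)%C = RtoC 1 -> exists k : Z, t = 2 * PI * IZR k.
Proof.
intros Hr E.
unfold expi, RtoC, Cmult in E; simpl in E; injection E as Ec Es.
assert (Hs : sin t = 0) by nra.
assert (Hc : 0 < cos t) by nra.
assert (Hc1 : cos t = 1).
{ pose proof (sin2_cos2 t) as H; unfold Rsqr in H; nra. }
assert (H0 : sin (t / 2) = 0).
{ replace t with (2 * (t / 2)) in Hc1 by field.
  rewrite cos_2a_sin in Hc1; nra. }
destruct (sin_eq_0_0 _ H0) as [k Hk].
exists k; lra.
Qed.

Lemma oa_cycle_sum (a b c : C) :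
  a <> RtoC 0 -> b <> RtoC 0 -> c <> RtoC 0 ->
  let S := oa a b + oa b c + oa c a in S = 0 \/ S = 2 * PI \/ S = 4 * PI.
Proof.
intros Ha Hb Hc S.
destruct (oa_spec a b Ha Hb) as [Hx [p [Hp Ep]]].
destruct (oa_spec b c Hb Hc) as [Hy [q [Hq Eq]]].
destruct (oa_spec c a Hc Ha) as [Hz [r [Hr Er]]].
assert (E : (RtoC (p * q * r) * expi S)%C = RtoC 1).
{ transitivity ((b / a) * (c / b) * (a / c))%C.
  - rewrite Ep, Eq, Er; unfold S; rewrite !expi_plus, !RtoC_mult; ring.
  - field; auto. }
apply expi_positive_real in E as [k Hk].
2: { apply Rmult_lt_0_compat; [apply Rmult_lt_0_compat|]; assumption. }
pose proof PI_RGT_0 as Hpi.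
assert (Hk0 : (-1 < k)%Z) by (apply lt_IZR; unfold S in Hk; nra).
assert (Hk3 : (k < 3)%Z) by (apply lt_IZR; unfold S in Hk; nra).
assert (k = 0 \/ k = 1 \/ k = 2)%Z as [-> | [-> | ->]] by lia; lra.
Qed.

(** The case analysis on the sum of the angles, with [h] in the role of [PI]. *)
Lemma turning_sum_iff (h x y z : R) :
  0 < h -> 0 <= x < 2 * h -> 0 <= y < 2 * h -> 0 <= z < 2 * h ->
  x + y + z = 0 \/ x + y + z = 2 * h \/ x + y + z = 4 * h ->
  (Rmin x (2 * h - x) + Rmin y (2 * h - y) + Rmin z (2 * h - z) = 2 * h <->
   (0 < Rmax (Rmax x y) z <= h \/ Rmin (Rmin x y) z >= h)).
Proof.
intros Hh Hx Hy Hz HS.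
(* Max and min enter only through comparisons with 0 and h; replacing these by
   conditions on x, y, z first avoids a case split on their relative order. *)
assert (Hmax : 0 < Rmax (Rmax x y) z <= h <->
               (0 < x \/ 0 < y \/ 0 < z) /\ x <= h /\ y <= h /\ z <= h).
{ unfold Rmax; repeat destruct Rle_dec; lra. }
assert (Hmin : Rmin (Rmin x y) z >= h <-> x >= h /\ y >= h /\ z >= h).
{ unfold Rmin; repeat destruct Rle_dec; lra. }
rewrite Hmax, Hmin; clear Hmax Hmin.
unfold Rmin; destruct HS as [HS | [HS | HS]]; repeat destruct Rle_dec; lra.
Qed.

Theorem theorem1 : forall a b c : C,
  a <> RtoC 0 -> b <> RtoC 0 -> c <> RtoC 0 ->
  (ta a b + ta b c + ta c a = 2 * PI <->
   (0 < Rmax (Rmax (oa a b) (oa b c)) (oa c a) <= PI \/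
    Rmin (Rmin (oa a b) (oa b c)) (oa c a) >= PI)).
Proof.
intros a b c Ha Hb Hc.
apply turning_sum_iff.
- exact PI_RGT_0.
- apply (oa_spec a b Ha Hb).
- apply (oa_spec b c Hb Hc).
- apply (oa_spec c a Hc Ha).
- exact (oa_cycle_sum a b c Ha Hb Hc).
Qed.
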